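(* Let $v\geq 1$ and $L,M\geq 0$ be integers. Then \[ \sum_{j=-\infty}^{\infty}(-1)^jq^{vj^2}{L+M-(v-1)j \brack L-vj}_q{L+v+M+(v-1)j \brack L+v+vj}_q=\sum_{j=-\infty}^{\infty}(-1)^jq^{vj^2}{L+M-(v-1)j \brack L-vj}_q{L+v-1+M+(v-1)j \brack L+v-1+vj}_q . \]
   Context: For integers $n\ge0$, $(q)_n=\prod_{j=1}^{n}(1-q^j)$. For integers $m,n$, ${n+m \brack n}_q=\frac{(q)_{n+m}}{(q)_n(q)_m}$ if $m,n\geq 0$ and $0$ otherwise. *)

(* Defs.v *)
From mathcomp Require Import all_boot all_order all_algebra.
From mathcomp Require Import zify.
From mathcomp Require Import boolp classical_sets functions cardinality fsbigop.

Set Implicit Arguments.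
Unset Strict Implicit.
Unset Printing Implicit Defensive.

Import Order.TTheory GRing.Theory Num.Theory.
Local Open Scope ring_scope.

Definition qfact (F : fieldType) (q : F) (n : nat) : F :=
  \prod_(1 <= j < n.+1) (1 - q ^+ j).

(* [qbinom q a b] is the Gaussian binomial with top a and bottom b; writing
   a = n + m and b = n, the two indices required to be nonnegative are b and
   a - b. *)
Definition qbinom (F : fieldType) (q : F) (a b : int) : F :=
  if (0 <= b) && (0 <= a - b)
  then qfact q (absz a) / (qfact q (absz b) * qfact q (absz (a - b)))
  else 0.

(* The domain on which the quotient defining qbinom has nonzero denominators:
   it covers q an indeterminate (in a field of rational functions) as well as a
   complex number with |q| < 1. *)
Definition not_root_of_unity (F : fieldType) (q : F) : Prop :=
  forall n : nat, (0 < n)%N -> q ^+ n != 1.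

Local Open Scope classical_set_scope.

(* A sum over [set: int] is 0 by convention when the summand has infinite
   support; summands of the shape below always have finite support. *)
Lemma qbinom_finite_support (F : fieldType) (q : F) (v L M : int)
    (c d : int -> F) : 1 <= v -> 0 <= L ->
  finite_set ([set: int] `&`
    (fun j => c j * qbinom q (L + M - (v - 1) * j) (L - v * j) * d j)
      @^-1` [set~ 0]).
Proof.
move=> v1 L0.
have : finite_set ((fun k : nat => k%:Z - M) @` `I_((absz (L + M)%R).+1)).
  exact/finite_image/finite_II.
apply: sub_finite_set => j [_ /= tj].
have /andP[h1 h2] :
    (0 <= L - v * j) && (0 <= L + M - (v - 1) * j - (L - v * j)).
  apply/negP => /negP h; apply: tj.
  by rewrite /qbinom (negbTE h) mulr0 mul0r.
have hM : 0 <= M + j by move: h2; lia.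
have hL : j <= L.
  have [j0|j0] := leP j 0; first by lia.
  by move: h1; nia.
by exists (absz (j + M)); rewrite /=; lia.
Qed.

(* Main.v *)
(* By the q-Pascal rule the difference of the two sums has general term
   (-1)^j q^(v j^2 + v j + v + L) A_j A_(-1-j), where A_j is the common
   binomial factor. It is odd under the fixed-point-free involution
   j |-> -1 - j, so its terms cancel in pairs. *)
Require Import Defs.
From mathcomp Require Import all_boot all_order all_algebra.
From mathcomp Require Import zify ring.
From mathcomp Require Import classical_sets fsbigop.

Import Order.TTheory GRing.Theory Num.Theory.
Local Open Scope ring_scope.
Local Open Scope classical_set_scope.

Lemma qfact0 (F : fieldType) (q : F) : qfact q 0 = 1.
Proof. by rewrite /qfact big_nil. Qed.

Lemma qfactS (F : fieldType) (q : F) (n : nat) :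
  qfact q n.+1 = qfact q n * (1 - q ^+ n.+1).
Proof. by rewrite /qfact big_nat_recr. Qed.

Lemma qfact_neq0 (F : fieldType) (q : F) (n : nat) :
  not_root_of_unity q -> qfact q n != 0.
Proof.
move=> hq; elim: n => [|n IH]; first by rewrite qfact0 oner_neq0.
by rewrite qfactS mulf_neq0 // subr_eq0 eq_sym hq.
Qed.

Lemma qbinom_nat (F : fieldType) (q : F) (k m : nat) :
  qbinom q (k%:Z + m%:Z) k%:Z = qfact q (k + m) / (qfact q k * qfact q m).
Proof.
rewrite /qbinom; have -> : k%:Z + m%:Z - k%:Z = m%:Z by lia.
by [].
Qed.

Lemma qbinom_out (F : fieldType) (q : F) (n k : int) :
  (k < 0) || (n < k) -> qbinom q n k = 0.
Proof.
move=> h; rewrite /qbinom ifF //.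
by apply/negP => /andP[h1 h2]; move: h; lia.
Qed.

Lemma qbinom_int0 (F : fieldType) (q : F) (n : int) :
  not_root_of_unity q -> 0 <= n -> qbinom q n 0 = 1.
Proof.
by move=> hq n0; rewrite /qbinom subr0 n0 qfact0 mul1r divff ?qfact_neq0.
Qed.

Lemma qbinom_intn (F : fieldType) (q : F) (n : int) :
  not_root_of_unity q -> 0 <= n -> qbinom q n n = 1.
Proof.
by move=> hq n0; rewrite /qbinom subrr n0 qfact0 mulr1 divff ?qfact_neq0.
Qed.

(** At [n = k = 0] the rule fails, since the left side is 1 and both binomials on the right are 0;
    everywhere else it survives the convention that out-of-range binomials vanish. *)
Lemma qbinom_pascal (F : fieldType) (q : F) (n k : int) :
  not_root_of_unity q -> (n != 0) || (k != 0) ->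
  qbinom q n k = qbinom q (n - 1) (k - 1) + q ^ k * qbinom q (n - 1) k.
Proof.
move=> hq nk.
have [h|] := boolP ((k < 0) || (n < k)).
  by rewrite !qbinom_out ?mulr0 ?addr0 //; move: h; lia.
rewrite negb_or -!leNgt => /andP[k0 kn].
have [m nE] : exists m : nat, n = k + m%:Z by exists (absz (n - k)); lia.
case: k k0 nk kn nE => // k _ nk _ nE; subst n.
case: k m nk => [|k] [|m] nk; first by move: nk; lia.
(* On each edge of the range, [k = 0] or [k = n], one right-hand binomial is out of range and the
   other is 1. *)
- rewrite [X in _ = X + _]qbinom_out // expr0z mul1r.
  by rewrite !qbinom_int0 ?add0r //; lia.
- rewrite [X in _ = _ + _ * X]qbinom_out ?mulr0 ?addr0; last by lia.
  by rewrite !qbinom_intn //; lia.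
- have -> : k.+1%:Z + m.+1%:Z - 1 = k%:Z + m.+1%:Z by lia.
  have -> : k.+1%:Z - 1 = k%:Z by lia.
  have := qbinom_nat _ q k.+1 m.
  have -> : k.+1%:Z + m%:Z = k%:Z + m.+1%:Z by lia.
  move=> ->; rewrite !qbinom_nat -exprnP !addSn !addnS !qfactS.
  have hk : 1 - q ^+ k.+1 != 0 by rewrite subr_eq0 eq_sym hq.
  have hm : 1 - q ^+ m.+1 != 0 by rewrite subr_eq0 eq_sym hq.
  (* With x = [q ^+ k.+1] and y = [q ^+ m.+1], the common factors leave 1 - x y = (1 - x) + x (1 -
     y). *)
  have -> : q ^+ (k + m).+2 = q ^+ k.+1 * q ^+ m.+1 by rewrite -exprD addSn addnS.
  by field; rewrite hk hm !qfact_neq0 //.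
Qed.

(** The window from -N to N - 1 is stable under j |-> -1 - j, and each orbit has exactly one
    nonnegative member; [Negz i] is that partner of [i]. *)
Lemma fsum_int_folded (V : zmodType) (f : int -> V) (N : nat) :
  (forall j : int, f j != 0 -> - N%:Z <= j < N%:Z) ->
  \sum_(j \in [set: int]) f j = \sum_(i < N) (f i%:Z + f (-1 - i%:Z)).
Proof.
move=> fN; pose r := map Posz (iota 0 N) ++ map Negz (iota 0 N).
have ur : uniq r.
  rewrite cat_uniq !map_inj_uniq ?iota_uniq ?andbT /=; try by move=> x y [].
  by apply/hasPn => _ /mapP[i _ ->]; apply/mapP => -[].
have <- : \sum_(j \in [set` r]) f j = \sum_(j \in [set: int]) f j.
  apply: fsbig_widen => // j [_ /= /negP jr]; apply/eqP; apply: contraT => /fN.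
  case: j jr => j jr hj; case/negP: jr; rewrite mem_cat; apply/orP;
    [left|right]; apply: map_f; rewrite mem_iota; move: hj; lia.
rewrite -fsbig_seq // big_cat /= !big_map -/(index_iota 0 N) -[N in iota 0 N]subn0.
rewrite -/(index_iota 0 N) !big_mkord -big_split /=.
by apply: eq_bigr => i _; congr (_ + f _); lia.
Qed.

Theorem theorem5p2 (F : fieldType) (q : F) (hq : not_root_of_unity q)
  (v L M : int) (hv : 1 <= v) (hL : 0 <= L) (hM : 0 <= M) :
  \sum_(j \in [set: int])
     ((-1) ^ j * q ^ (v * j ^+ 2)
      * qbinom q (L + M - (v - 1) * j) (L - v * j)
      * qbinom q (L + v + M + (v - 1) * j) (L + v + v * j))
  = \sum_(j \in [set: int])
     ((-1) ^ j * q ^ (v * j ^+ 2)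
      * qbinom q (L + M - (v - 1) * j) (L - v * j)
      * qbinom q (L + v - 1 + M + (v - 1) * j) (L + v - 1 + v * j)).
Proof.
pose A (j : int) := qbinom q (L + M - (v - 1) * j) (L - v * j).
pose e (j : int) := v * j ^+ 2 + (L + v + v * j).
pose D (j : int) : F := (-1) ^ j * q ^ e j * A j * A (-1 - j).
(* [A j] alone confines j to -M <= j <= L, so one window serves both sums. *)
have supp (c d : int -> F) j :
    c j * A j * d j != 0 -> - (absz (L + M)).+1%:Z <= j < (absz (L + M)).+1%:Z.
  rewrite !mulf_eq0 !negb_or => /andP[/andP[_ Aj] _].
  have : ~~ ((L - v * j < 0) || (L + M - (v - 1) * j < L - v * j)).
    by apply: contra Aj => h; rewrite /A qbinom_out.
  rewrite negb_or -!leNgt => /andP[h1 h2].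
  have jL : j <= L by have [j0|j0] := leP j 0; [lia | move: h1; nia].
  by move: h2; lia.
have step j : (-1) ^ j * q ^ (v * j ^+ 2) * A j
      * qbinom q (L + v + M + (v - 1) * j) (L + v + v * j)
    = (-1) ^ j * q ^ (v * j ^+ 2) * A j
      * qbinom q (L + v - 1 + M + (v - 1) * j) (L + v - 1 + v * j) + D j.
  rewrite (@qbinom_pascal _ _ (L + v + M + (v - 1) * j)) //; last first.
    (* Both indices being 0 would force j = M, and then L + v + v M = 0, although v >= 1. *)
    apply/norP => -[/negPn/eqP h1 /negPn/eqP h2].
    have jM : j = M by move: h1 h2; lia.
    by move: h2; rewrite jM; nia.
  have -> : L + v + M + (v - 1) * j - 1 = L + v - 1 + M + (v - 1) * j by lia.
  have -> : L + v + v * j - 1 = L + v - 1 + v * j by lia.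
  rewrite mulrDr; congr (_ + _).
  have AE : A (-1 - j) = qbinom q (L + v - 1 + M + (v - 1) * j) (L + v + v * j).
    by rewrite /A; congr (qbinom _ _ _); lia.
  (* The Pascal exponent is also the bottom index of [A (-1 - j)]: if it is negative, both sides
     vanish. *)
  rewrite -AE /D; have [h|h] := ltP (L + v + v * j) 0.
    by rewrite AE (@qbinom_out _ _ _ (L + v + v * j)) ?h // !mulr0.
  (* As q may be 0, q ^ (a + b) is split only for natural a and b. *)
  have [a aE] : exists a : nat, v * j ^+ 2 = a%:Z.
    exists (absz (v * j ^+ 2)); rewrite gez0_abs // mulr_ge0 ?sqr_ge0 //; lia.
  have [b bE] : exists b : nat, L + v + v * j = b%:Z.
    by exists (absz (L + v + v * j)); rewrite gez0_abs.
  by rewrite /e aE bE -PoszD -!exprnP exprD; ring.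
have D_anti j : D j + D (-1 - j) = 0.
  rewrite /D; have -> : -1 - (-1 - j) = j by lia.
  (* Here e(j) = v j (j + 1) + L + v, and j (j + 1) is invariant under the involution, so only the
     sign changes. *)
  have -> : e (-1 - j) = e j by rewrite /e; ring.
  have -> : (-1) ^ (-1 - j) = - (-1) ^ j :> F.
    by rewrite expfzDr ?oppr_eq0 ?oner_eq0 //
       -exprz_inv exprN1 !invrN1 mulN1r.
  ring.
rewrite !(@fsum_int_folded _ _ (absz (L + M)).+1); last 2 first.
- exact: supp.
- exact: supp.
(* The two sums agree orbit by orbit: [addrACA] brings together the two [D] terms of each pair. *)
by apply: eq_bigr => i _; rewrite -!/(A _) !step addrACA D_anti addr0.
Qed.
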